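(* Let $A = \prod_{i=1}^m \mathbb Z/n_i$ be a product of non-trivial finite cyclic groups. If $\mathcal H = \{H_1, \dots, H_{m'}\}$ is a hyperplane splitting of $A$ with $U(\mathcal H) = \mathcal Z(A)$, then up to a permutation of the $H_i$ we have: (a) when $n_i > 2$, we have $\vec z_i \in H_i$; (b) each $H_i$ is a nearly-coordinate hyperplane; (c) $m = m'$ and each $A/H_i'$ is a cyclic group of order $n_i$.
   Context: Affine hyperplanes: a linear hyperplane in an abelian group $A$ is a proper subgroup with cyclic quotient; an affine hyperplane $H$ is a coset $x+H'$ of a linear hyperplane $H'$, called the linear translate of $H$. A hyperplane splitting of $A$ is an unordered collection $\mathcal H = \{H_1,\dots,H_{m'}\}$ of affine hyperplanes such that the induced map $A \to \prod_{i=1}^{m'} A/H_i'$ is an isomorphism; its hyperplane union is $U(\mathcal H) = \bigcup_i H_i$. For $A = \prod_{i=1}^m \mathbb Z/n_i$ with all $n_i\ge 2$: $\mathcal Z(A)$ is the set of elements of $A$ with at least one coordinate equal to zero; $\vec z_i \in A$ is the vector whose $i$-th coordinate is $0$ and all of whose other coordinates are $1$; $\vec e_i$ is the $i$-th standard basis vector. Nearly-coordinate hyperplanes: fix an index $j$. If $n_j = 2r$ is even, choose a homomorphism $\phi: \prod_{i\neq j}\mathbb Z/n_i \to \mathbb Z/2$ such that $\phi(\vec e_i) \ne 0$ only if $n_i = 2$; the corresponding nearly-$Z_j$ hyperplane is $$Z_\phi = \big\{x \in A \mid x_j = r\big(\phi((x_i)_{i\ne j}) + \phi(\vec 1)\big)\big\},$$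 where $\vec 1$ is the vector of all ones and multiplication by $r$ is viewed as the injection $\mathbb Z/2 \to \mathbb Z/2r$. If $n_j$ is odd, the only nearly-$Z_j$ hyperplane is the coordinate hyperplane $Z_j=\{x\in A \mid x_j = 0\}$. A nearly-coordinate hyperplane is one that is nearly-$Z_j$ for some $j$. *)

(* Defs.v *)
From mathcomp Require Import all_boot all_order all_algebra.
From mathcomp Require Import all_fingroup all_solvable.

Set Implicit Arguments.
Unset Strict Implicit.
Unset Printing Implicit Defensive.

Import GroupScope.

(* MathComp's finite groups are written multiplicatively. The definitions of
   this section are only meant for an abelian group [gT]; then every [G] is
   normal and [coset_of G] is the whole quotient of [gT] by [G]. *)
Section Hyperplanes.
Variable gT : finGroupType.

Definition linear_hyperplane (G : {group gT}) : Prop :=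
  G \proper [set: gT] /\ cyclic ([set: gT] / G).

(* [H] is an affine hyperplane whose linear translate is [H'], which [H]
   determines. *)
Definition affine_hyperplane (H : {set gT}) (H' : {group gT}) : Prop :=
  linear_hyperplane H' /\ exists x : gT, H = x *: H'.

Definition quotient_map m' (H' : 'I_m' -> {group gT}) (x : gT) :
    {dffun forall i : 'I_m', coset_of (H' i)} :=
  [ffun i => coset (H' i) x].

(* A collection is given by an enumeration; no affine hyperplane can occur twice
   in a splitting, since the linear translates are proper subgroups. *)
Definition hyperplane_splitting m'
    (H : 'I_m' -> {set gT}) (H' : 'I_m' -> {group gT}) : Prop :=
  (forall i, affine_hyperplane (H i) (H' i)) /\
  misom [set: gT] [set: {dffun forall i : 'I_m', coset_of (H' i)}]
    (quotient_map H').

Definition hyperplane_union m' (H : 'I_m' -> {set gT}) : {set gT} :=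
  \bigcup_(i < m') H i.

End Hyperplanes.

(* The product of the groups Z/n_i, whose [finGroupType] operation is
   coordinatewise addition. It is used only when all [n i > 1], as ['Z_k] is Z/2
   when [k < 2]. *)
Notation Zprod n := {dffun forall i, 'Z_(n i)}.

Section Vectors.
Variables (I : finType) (n : I -> nat).

Definition ones : Zprod n := [ffun i => 1%R : 'Z_(n i)].

Definition evec (i : I) : Zprod n := [ffun k => (k == i)%:R%R : 'Z_(n k)].

Definition zvec (i : I) : Zprod n := [ffun k => (k != i)%:R%R : 'Z_(n k)].

Definition zero_coord_set : {set Zprod n} :=
  [set x : Zprod n | [exists i, x i == 0%R]].

End Vectors.

Section NearlyCoordinate.
Variables (m : nat) (n : 'I_m -> nat).

Local Notation others j := {i : 'I_m | i != j}.

Definition others_n (j : 'I_m) (i : others j) : nat := n (val i).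

Definition drop_coord (j : 'I_m) (x : Zprod n) : Zprod (@others_n j) :=
  [ffun i => x (val i) : 'Z_(others_n i)].

Definition coord_hyperplane (j : 'I_m) : {set Zprod n} :=
  [set x : Zprod n | x j == 0%R].

(* Multiplication by [r] from Z/2 to Z/2r, where [k = 2r]. *)
Definition half_mul (k : nat) (b : 'Z_2) : 'Z_k := ((k./2 * b)%N%:R)%R.

Definition nearly_hyperplane (j : 'I_m)
    (phi : {morphism [set: Zprod (@others_n j)] >-> 'Z_2}) : {set Zprod n} :=
  [set x : Zprod n |
    x j == half_mul (n j) (phi (drop_coord j x) + phi (ones (@others_n j)))%R].

Definition nearly_Z (j : 'I_m) (H : {set Zprod n}) : Prop :=
  if odd (n j) then H = coord_hyperplane j
  else exists phi : {morphism [set: Zprod (@others_n j)] >-> 'Z_2},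
         (forall i : others j, phi (evec (@others_n j) i) <> 0%R -> n (val i) = 2)
         /\ H = nearly_hyperplane phi.

Definition nearly_coordinate (H : {set Zprod n}) : Prop :=
  exists j : 'I_m, nearly_Z j H.

End NearlyCoordinate.

(* Main.v *)
Require Import Defs.
From mathcomp Require Import all_boot all_order all_algebra.
From mathcomp Require Import all_fingroup all_solvable.
From mathcomp Require Import zify.

Set Implicit Arguments.
Unset Strict Implicit.
Unset Printing Implicit Defensive.

(** Let D be the set of the vectors of A all of whose coordinates are nonzero.
    It is the complement of Z(A), hence, for a splitting with hyperplane union
    Z(A), also the set of the points that avoid every H_j. So D is a product of
    punctured cyclic groups in two ways: for the given decomposition of A into
    the groups Z/n_i, and for the decomposition of A into the quotients A/H_j'.
    The proof recovers from D and the group law alone as much of such a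
    decomposition as they determine.

    The number N(v) of the points x of D such that v x is in D is a product
    over the factors Q of the decomposition: a factor on which v is trivial
    contributes #|Q| - 1, any other one contributes #|Q| - 2
    ([autocorrelationE]). If N(v) is positive then v is trivial on the factors
    of order 2, and a factorization v = a b satisfies N(a) N(b) = N(v) N(1)
    exactly when a and b have disjoint supports. Therefore the nontrivial v
    with N(v) positive that have only trivial factorizations of this kind are
    those lying on the axis of one factor of order greater than 2 ([atomicP]).
    Two such vectors are on the same axis if and only if their quotient is
    trivial or again of this kind, so two decompositions with the same D have
    the same axes of order greater than 2 ([axis_match]). Comparing the orders
    of the groups shows that they also have as many factors of order 2
    ([factors_match]), which gives the permutation and the orders in (c).

    The axes of order 2 are not determined by D, and this is the source of the
    homomorphisms phi. Let H_j be matched with a coordinate i such that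
    n_i > 2. The quotient map A -> A/H_j' is injective on the i-th axis, so it
    can be read as a map p : A -> Z/n_i extending the i-th coordinate of that
    axis. It vanishes on the other axes of order greater than 2, so that p
    minus the i-th coordinate only sees the axes of order 2 and has values of
    order at most 2: it is zero if n_i is odd, and r phi if n_i = 2r
    ([projection_nearly]). Finally, z_i is in Z(A) but moving it along the i-th
    axis yields points of D; as such a move only changes the j-th coset, z_i
    lies in H_j. If A/H_j' has order 2, there is a coordinate i such that e_i
    is not in H_j'; then n_i = 2, again z_i lies in H_j, and H_j is nearly Z_i
    by the same argument. *)

(** * Decompositions of a group and their axes *)

Lemma eq_prodn_le (I : finType) (u w : I -> nat) :
  (forall i, u i <= w i) -> (forall i, 0 < w i) ->
  \prod_i u i = \prod_i w i -> forall i, u i = w i.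
Proof.
move=> le_uw w_gt0 eq_uw i; apply/eqP; rewrite eqn_leq le_uw /= leqNgt.
apply/negP=> lt_uw; move: (eq_uw); apply/eqP; rewrite neq_ltn; apply/orP; left.
rewrite (bigD1 i) //= [X in _ < X](bigD1 i) //=.
have le_rest: \prod_(k | k != i) u k <= \prod_(k | k != i) w k.
  by apply: leq_prod => k _.
apply: leq_ltn_trans (leq_mul (leqnn _) le_rest) _.
by rewrite ltn_pmul2r // prodn_gt0.
Qed.

Section Decompositions.
Local Open Scope group_scope.

(** A direct product decomposition is given by its projections and not by an
    isomorphism, so that the coordinates of A and the cosets of the linear
    translates are two instances of it on the same group. *)
Definition decomposition (gT : finGroupType) (I : finType)
    (Q : I -> finGroupType) (f : forall i, gT -> Q i) : Prop :=
  [/\ forall i, {morph f i : x y / x * y},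
      forall x y, (forall i, f i x = f i y) -> x = y
    & forall y : (forall i, Q i), exists x, forall i, f i x = y i].

Definition avoiding (gT I : finType) (Q : I -> finType)
    (f : forall i, gT -> Q i) (c : forall i, Q i) : {set gT} :=
  [set x | [forall i, f i x != c i]].

Definition axis (gT I : finType) (Q : I -> finGroupType)
    (f : forall i, gT -> Q i) (i : I) : {set gT} :=
  [set x | [forall (k | k != i), f k x == 1]].

Definition autocorrelation (gT : finGroupType) (D : {set gT}) (v : gT) : nat :=
  #|[set x in D | v * x \in D]|.

(** In terms of a decomposition for which [D] is a product set, the equation
    says that [a] and [b] have disjoint supports. The definition refers only to
    [D], hence is shared by all decompositions. *)
Definition atomic (gT : finGroupType) (D : {set gT}) (v : gT) : Prop :=
  [/\ v != 1, 0 < autocorrelation D v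
    & forall a b, a * b = v ->
        (autocorrelation D a * autocorrelation D b
          = autocorrelation D v * autocorrelation D 1)%N ->
        a = 1 \/ b = 1].

Section Coordinates.
Variables (gT : finGroupType) (I : finType) (Q : I -> finGroupType).
Variable f : forall i, gT -> Q i.
Hypothesis f_dec : decomposition f.

Lemma decM i : {morph f i : x y / x * y}.
Proof. by case: f_dec. Qed.

Lemma dec_inj x y : (forall i, f i x = f i y) -> x = y.
Proof. by case: f_dec => _ + _; apply. Qed.

Lemma dec_surj (y : forall i, Q i) : exists x, forall i, f i x = y i.
Proof. by case: f_dec => _ _; apply. Qed.

Lemma dec1 i : f i 1 = 1.
Proof. by apply: (@mulgI _ (f i 1)); rewrite -decM !mulg1. Qed.

Lemma decV i x : f i x^-1 = (f i x)^-1.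
Proof. by apply: (@mulgI _ (f i x)); rewrite -decM !mulgV dec1. Qed.

Lemma axisP i x : reflect (forall k, k != i -> f k x = 1) (x \in axis f i).
Proof.
rewrite inE; apply: (iffP forall_inP) => h k ki; first exact/eqP/h.
exact/eqP/h.
Qed.

Lemma axis_coord i (q : Q i) : exists2 x, x \in axis f i & f i x = q.
Proof.
have [x fx] := dec_surj (dfwith (fun k => 1 : Q k) q).
exists x; last by rewrite fx dfwith_in.
by apply/axisP=> k ki; rewrite fx dfwith_out // eq_sym.
Qed.

Lemma axis_inj i : {in axis f i &, injective (f i)}.
Proof.
move=> x y /axisP x_i /axisP y_i eq_xy; apply: dec_inj => k.
by have [->|ki] := eqVneq k i; rewrite // x_i ?y_i.
Qed.

Lemma axis1 i : 1 \in axis f i.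
Proof. by apply/axisP => k _; apply: dec1. Qed.

Lemma axis_neq1 i x : x \in axis f i -> x != 1 -> f i x != 1.
Proof.
move=> x_i; apply: contraNneq => fx1; apply/eqP.
by apply: (axis_inj x_i (axis1 i)); rewrite fx1 dec1.
Qed.

Lemma axisM i x y : x \in axis f i -> y \in axis f i -> x * y \in axis f i.
Proof.
by move=> /axisP hx /axisP hy; apply/axisP => k ki; rewrite decM hx ?hy ?mulg1.
Qed.

Lemma axisV i x : x \in axis f i -> x^-1 \in axis f i.
Proof. by move=> /axisP hx; apply/axisP => k ki; rewrite decV hx ?invg1. Qed.

Lemma axes_disjoint i k x :
  x \in axis f i -> x \in axis f k -> x != 1 -> i = k.
Proof.
move=> x_i /axisP x_k x1; apply/eqP; apply: contraNT (axis_neq1 x_i x1) => ik.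
by rewrite x_k.
Qed.

Lemma card_axis i : #|axis f i| = #|Q i|.
Proof.
rewrite -(card_in_imset (@axis_inj i)); apply/eqP; rewrite -cardsT eqn_leq.
apply/andP; split; apply: subset_leq_card; rewrite ?subsetT //.
by apply/subsetP=> q _; have [x x_i <-] := axis_coord q; apply: imset_f.
Qed.

Lemma card_family_dec (F : forall i, {set Q i}) :
  #|[set x | [forall i, f i x \in F i]]| = (\prod_i #|F i|)%N.
Proof.
pose h x : {dffun forall i, Q i} := [ffun i => f i x].
have h_inj: injective h.
  by move=> x y /ffunP hxy; apply: dec_inj => i; have := hxy i; rewrite !ffunE.
rewrite -(card_imset _ h_inj).
rewrite -cardsXn; apply: eq_card => y.
apply/imsetP/setXnP => [[x] | hy].
  by rewrite inE => /forallP xF -> i; rewrite ffunE; apply: xF.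
have [x fx] := dec_surj y; exists x; last by apply/ffunP=> i; rewrite ffunE fx.
by rewrite inE; apply/forallP=> i; rewrite fx; apply: hy.
Qed.

Lemma card_dec : #|gT| = (\prod_i #|Q i|)%N.
Proof.
transitivity (\prod_i #|[set: Q i]|)%N; last first.
  by apply: eq_bigr => i _; rewrite cardsT.
rewrite -card_family_dec -cardsT; apply: eq_card => x; rewrite !inE.
by symmetry; apply/forallP=> i; rewrite inE.
Qed.

(** Dividing [x] by its component on an axis decreases its number of nontrivial
    coordinates. *)
Lemma axes_generate (hT : finGroupType) (h : gT -> hT) :
  {morph h : x y / x * y} -> (forall i x, x \in axis f i -> h x = 1) ->
  forall x, h x = 1.
Proof.
move=> hM h_axis x; have [k] := ubnP #|[set i | f i x != 1]|.
elim: k x => // k IHk x; rewrite ltnS => le_k.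
have [i fx1|fx] := pickP [pred i | f i x != 1]; last first.
  have -> : x = 1.
    by apply: dec_inj => i; rewrite dec1; apply/eqP/negbFE/fx.
  by apply: (@mulgI _ (h 1)); rewrite -hM !mulg1.
have [a a_i fa] := axis_coord (f i x).
rewrite -(mulKVg a x) hM (h_axis i) // mul1g; apply: IHk.
apply: leq_trans le_k; apply: proper_card; apply/properP; split.
  apply/subsetP=> l; rewrite !inE; apply: contraNneq => fx.
  have [->|li] := eqVneq l i; first by rewrite decM decV fa mulVg.
  by rewrite decM decV (axisP _ _ a_i) // fx mulVg.
by exists i; rewrite ?inE //= decM decV fa mulVg eqxx.
Qed.

Hypothesis Q_gt1 : forall i, 1 < #|Q i|.
Variable c : forall i, Q i.
Let D := avoiding f c.

Definition weight (i : I) (q : Q i) : nat := #|Q i| - (q != 1).+1.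

(** Both conditions on [x] bear on each coordinate separately: they exclude the
    values [c i] and [(f i v)^-1 * c i], which coincide exactly when
    [f i v] is trivial. *)
Lemma autocorrelationE v : autocorrelation D v = (\prod_i weight (f i v))%N.
Proof.
transitivity (\prod_i #|~: [set c i; ((f i v)^-1 * c i)%g]|)%N.
  rewrite -card_family_dec; apply: eq_card => x; rewrite !inE.
  apply/andP/forallP=> [[/forallP xD /forallP vxD] i | h].
    rewrite !inE negb_or xD /=; apply: contra (vxD i) => /eqP eq_x.
    by rewrite decM eq_x mulKVg.
  split; apply/forallP=> i; have:= h i; rewrite !inE negb_or => /andP[] //.
  by move=> _; apply: contra => /eqP; rewrite decM => <-; rewrite mulKg.
apply: eq_bigr => i _; rewrite cardsCs setCK cards2 /weight.
congr (_ - (~~ _).+1); apply/eqP/eqP=> [eq_c | ->]; last by rewrite invg1 mul1g.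
by apply: (mulIg (c i)); rewrite mul1g [in LHS]eq_c mulKVg.
Qed.

Lemma weight1 i : weight (1 : Q i) = (#|Q i|).-1.
Proof. by rewrite /weight eqxx subn1. Qed.

Lemma weight_neq1 i (q : Q i) : q != 1 -> weight q = (#|Q i|).-2.
Proof. by rewrite /weight => ->; rewrite subn2. Qed.

Lemma weight_lt i (q : Q i) : q != 1 -> weight q < (#|Q i|).-1.
Proof. by move/weight_neq1->; have := Q_gt1 i; case: #|Q i| => [|[]]. Qed.

Lemma weight_le i (q : Q i) : weight q <= (#|Q i|).-1.
Proof.
by have [->|/weight_lt/ltnW//] := eqVneq q 1; rewrite weight1.
Qed.

(** A vector [v] splits as its component on an axis times the rest, with
    multiplicative autocorrelations; so an atomic [v] lies on one axis.
    Conversely, let [v] lie on the axis [i]. In each coordinate the product of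
    the weights of [a] and [b] is at most that of the weights of [v] and [1],
    so equality of the products forces equality in each coordinate. This makes
    [a] and [b] trivial outside [i], and one of them trivial in [i]. *)
Lemma atomicP v :
  atomic D v <-> exists i, [/\ 2 < #|Q i|, v \in axis f i & v != 1].
Proof.
split=> [[v1 corr_gt0 v_ind] | [i [Qi v_i v1]]].
  have [i fv1]: exists i, f i v != 1.
    apply/existsP; apply: contraR v1; rewrite negb_exists => /forallP fv.
    by apply/eqP/dec_inj => i; have:= fv i; rewrite negbK dec1 => /eqP.
  have Qi: 2 < #|Q i|.
    move: corr_gt0; rewrite autocorrelationE (bigD1 i) //= muln_gt0.
    by rewrite weight_neq1 // => /andP[]; case: #|Q i| => [|[|[]]].
  have [a a_i fa] := axis_coord (f i v).
  exists i; split=> //; suff -> : v = a by [].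
  have fa1 : a <> 1 by move=> a1; move: fv1; rewrite -fa a1 dec1 eqxx.
  have [||//|] := v_ind a (a^-1 * v); first by rewrite mulKVg.
    rewrite !autocorrelationE -!big_split; apply: eq_bigr => k _ /=.
    rewrite decM decV dec1; have [->|ki] := eqVneq k i.
      by rewrite fa mulVg.
    by rewrite (axisP _ _ a_i) // invg1 mul1g mulnC.
  by move/(congr1 (mulg a)); rewrite mulKVg mulg1.
have fv1 := axis_neq1 v_i v1.
split=> // [|a b ab_v].
  rewrite autocorrelationE prodn_gt0 // => k; have [->|ki] := eqVneq k i.
    by rewrite weight_neq1 //; case: #|Q i| Qi => [|[|[]]].
  by rewrite (axisP _ _ v_i) // weight1; have := Q_gt1 k; case: #|Q k| => [|[]].
rewrite !autocorrelationE -!big_split /= => eq_ab.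
have eq_k k : (weight (f k a) * weight (f k b)
             = weight (f k v) * weight (f k 1))%N.
  apply: eq_prodn_le eq_ab k => k; rewrite ?muln_gt0 dec1 weight1.
    have [->|ki] := eqVneq k i; last first.
      by rewrite (axisP _ _ v_i) // weight1 leq_mul ?weight_le.
    have [fa1|/weight_neq1 wa] := eqVneq (f i a) 1.
      by rewrite -ab_v decM fa1 mul1g weight1 mulnC.
    by rewrite (weight_neq1 fv1) wa leq_mul ?weight_le.
  rewrite ltn_predRL Q_gt1 andbT.
  have [->|ki] := eqVneq k i.
    by rewrite (weight_neq1 fv1); case: #|Q i| Qi => [|[|[]]].
  by rewrite (axisP _ _ v_i) // weight1; have := Q_gt1 k; case: #|Q k| => [|[]].
(* The largest weight is reached only by the trivial element. *)
have off k : k != i -> f k a = 1 /\ f k b = 1.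
  move=> ki; have ab1: f k a * f k b = 1 by rewrite -decM ab_v (axisP _ _ v_i).
  suff a1: f k a = 1 by split=> //; move: ab1; rewrite a1 mul1g.
  apply/eqP; have := eq_k k; rewrite (axisP _ _ v_i) // dec1 weight1.
  apply: contra_eqT => a1; rewrite neq_ltn; apply/orP; left.
  apply: leq_ltn_trans (leq_mul (leqnn _) (weight_le _)) _.
  by rewrite ltn_pmul2r ?weight_lt // (leq_ltn_trans _ (weight_lt a1)).
have [fa1|fa1] := eqVneq (f i a) 1.
  left; apply: dec_inj => k; rewrite dec1.
  by have [->|/off[]] := eqVneq k i.
right; apply: dec_inj => k; rewrite dec1.
have [->|/off[]//] := eqVneq k i.
apply/eqP; have := eq_k i; rewrite dec1 weight1 (weight_neq1 fv1).
rewrite (weight_neq1 fa1); apply: contra_eqT => /weight_lt b_lt.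
rewrite neq_ltn ltn_pmul2l ?b_lt //.
by case: #|Q i| Qi => [|[|[]]].
Qed.

End Coordinates.

(** * Two decompositions with the same avoiding set *)

Section Comparison.
Variables (gT : finGroupType).

(** Distinct elements of an axis have an atomic quotient, whereas the quotient
    of nontrivial elements of two different axes is nontrivial in two
    coordinates. So the whole axis [i] of [f] follows [v] into one axis of
    [g]. *)
Lemma axis_sub (I : finType) (Q : I -> finGroupType) (f : forall i, gT -> Q i)
    (J : finType) (R : J -> finGroupType) (g : forall j, gT -> R j)
    (c : forall i, Q i) (d : forall j, R j) (i : I) (v : gT) :
  decomposition f -> decomposition g ->
  (forall i, 1 < #|Q i|) -> (forall j, 1 < #|R j|) ->
  avoiding f c = avoiding g d ->
  2 < #|Q i| -> v \in axis f i -> v != 1 ->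
  exists j, [/\ 2 < #|R j|, v \in axis g j & axis f i \subset axis g j].
Proof.
move=> f_dec g_dec Q_gt1 R_gt1 eqD Qi v_i v1.
have on_axis u : u \in axis f i -> u != 1 ->
    exists j, [/\ 2 < #|R j|, u \in axis g j & u != 1].
  move=> u_i u1; apply/(atomicP g_dec R_gt1 d); rewrite -eqD.
  by apply/(atomicP f_dec Q_gt1 c); exists i.
have [j [Rj v_j _]] := on_axis v v_i v1; exists j; split=> //.
apply/subsetP=> u u_i; have [->|u1] := eqVneq u 1; first exact: axis1.
have [->//|uv] := eqVneq u v.
have [k [_ u_k _]] := on_axis u u_i u1.
have [l [_ uv_l _]]: exists l,
    [/\ 2 < #|R l|, u^-1 * v \in axis g l & u^-1 * v != 1].
  apply: on_axis; first by rewrite axisM ?axisV.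
  by apply: contraNneq uv => uv1; rewrite -(mulKVg u v) uv1 mulg1.
have [<-//|kj] := eqVneq k j.
have lj: l = j.
  apply/eqP; apply: contraNT (axis_neq1 g_dec v_j v1) => lj.
  have := axisP _ _ _ uv_l j; rewrite eq_sym lj => /(_ isT).
  rewrite (decM g_dec) (decV g_dec) (axisP _ _ _ u_k) 1?eq_sym //.
  by rewrite invg1 mul1g => ->.
have := axisP _ _ _ uv_l k; rewrite lj kj => /(_ isT).
rewrite (decM g_dec) (decV g_dec) (axisP _ _ _ v_j) // mulg1 => /eqP.
by rewrite invg_eq1 (negPf (axis_neq1 g_dec u_k u1)).
Qed.

Lemma axis_match (I : finType) (Q : I -> finGroupType) (f : forall i, gT -> Q i)
    (J : finType) (R : J -> finGroupType) (g : forall j, gT -> R j)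
    (c : forall i, Q i) (d : forall j, R j) (i : I) :
  decomposition f -> decomposition g ->
  (forall i, 1 < #|Q i|) -> (forall j, 1 < #|R j|) ->
  avoiding f c = avoiding g d ->
  2 < #|Q i| -> exists2 j, 2 < #|R j| & axis f i = axis g j.
Proof.
move=> f_dec g_dec Q_gt1 R_gt1 eqD Qi.
have [v v_i v1]: exists2 v, v \in axis f i & v != 1.
  have /card_gt0P[q]: 0 < #|[set~ 1 : Q i]| by rewrite cardsC1 ltn_predRL.
  rewrite !inE => q1; have [v v_i fv] := axis_coord f_dec q.
  by exists v => //; apply: contraNneq q1 => v1; rewrite -fv v1 (dec1 f_dec).
have [j [Rj v_j ij]] := axis_sub f_dec g_dec Q_gt1 R_gt1 eqD Qi v_i v1.
exists j => //; apply/eqP; rewrite eqEsubset ij /=.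
have [k [_ v_k jk]] := axis_sub g_dec f_dec R_gt1 Q_gt1 (esym eqD) Rj v_j v1.
by rewrite (axes_disjoint f_dec v_i v_k v1).
Qed.

Variables (I : finType) (Q : I -> finGroupType) (f : forall i, gT -> Q i).
Variables (J : finType) (R : J -> finGroupType) (g : forall j, gT -> R j).
Hypotheses (f_dec : decomposition f) (g_dec : decomposition g).
Hypotheses (Q_gt1 : forall i, 1 < #|Q i|) (R_gt1 : forall j, 1 < #|R j|).
Variables (c : forall i, Q i) (d : forall j, R j).
Hypothesis eqD : avoiding f c = avoiding g d.

Definition big_factors (K : finType) (S : K -> finGroupType) : {set K} :=
  [set k | 2 < #|S k|].

Lemma axis_of_inj (K : finType) (S : K -> finGroupType)
    (h : forall k, gT -> S k) :
  decomposition h -> (forall k, 1 < #|S k|) -> injective (axis h).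
Proof.
move=> h_dec S_gt1 k l eq_kl.
have /card_gt0P[q]: 0 < #|[set~ 1 : S k]| by rewrite cardsC1 ltn_predRL.
rewrite !inE => q1; have [v v_k hv] := axis_coord h_dec q.
apply: (axes_disjoint h_dec v_k); first by rewrite -eq_kl.
by apply: contraNneq q1 => v1; rewrite -hv v1 (dec1 h_dec).
Qed.

Lemma big_axes :
  [set axis f i | i in big_factors Q] = [set axis g j | j in big_factors R].
Proof.
apply/setP=> X; apply/imsetP/imsetP=> [[i] | [j]]; rewrite inE => big ->.
  have [j Rj ->] := axis_match f_dec g_dec Q_gt1 R_gt1 eqD big.
  by exists j; rewrite ?inE.
have [i Qi ->] := axis_match g_dec f_dec R_gt1 Q_gt1 (esym eqD) big.
by exists i; rewrite ?inE.
Qed.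

Lemma card_big : #|big_factors Q| = #|big_factors R|.
Proof.
have:= congr1 (fun X : {set {set gT}} => #|X|) big_axes.
by rewrite /= !card_imset //; apply: axis_of_inj.
Qed.

(** The first factor depends only on the set of the axes of order greater than
    2; hence it is the same for two decompositions with the same avoiding
    set. *)
Lemma card_split (K : finType) (S : K -> finGroupType)
    (h : forall k, gT -> S k) :
  decomposition h -> (forall k, 1 < #|S k|) ->
  (#|gT| = \prod_(X in [set axis h k | k in big_factors S]) #|X|
            * 2 ^ #|~: big_factors S|)%N.
Proof.
move=> h_dec S_gt1; rewrite (card_dec h_dec) (bigID (mem (big_factors S))) /=.
congr (_ * _)%N.
  rewrite big_imset /=; last by move=> k l _ _; apply: axis_of_inj.
  by apply: eq_bigr => k _; rewrite (card_axis h_dec).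
rewrite -prod_nat_const; apply: eq_big => k; rewrite !inE // => small.
by apply/eqP; rewrite eqn_leq S_gt1 leqNgt small.
Qed.

Lemma card_small : #|~: big_factors Q| = #|~: big_factors R|.
Proof.
have := card_split f_dec Q_gt1; rewrite (card_split g_dec R_gt1) -big_axes.
move/eqP; rewrite eqn_pmul2l; last first.
  apply: prodn_cond_gt0 => _ /imsetP[i _ ->].
  by rewrite (card_axis f_dec) ltnW.
by rewrite eqn_exp2l // => /eqP.
Qed.

(** The factors of order 2 have no distinguished pairing; they are paired by
    their rank. *)
Lemma factors_match :
  exists t : I -> J,
    [/\ injective t,
        forall i, #|R (t i)| = #|Q i|
      & forall i, 2 < #|Q i| -> axis f i = axis g (t i)].
Proof.
pose S := enum (~: big_factors Q); pose S' := enum (~: big_factors R).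
have szS : size S = size S' by rewrite -!cardE card_small.
have memS i : (i \in S) = (#|Q i| == 2).
  by rewrite mem_enum !inE -leqNgt eqn_leq Q_gt1 andbT.
have memS' j : (j \in S') = (#|R j| == 2).
  by rewrite mem_enum !inE -leqNgt eqn_leq R_gt1 andbT.
have /fin_all_exists[t tP] i : exists j,
  [/\ #|R j| = #|Q i|, 2 < #|Q i| -> axis f i = axis g j
     & #|Q i| = 2 -> index i S = index j S'].
  have [big | small] := ltnP 2 #|Q i|.
    have [j Rj eq_ij] := axis_match f_dec g_dec Q_gt1 R_gt1 eqD big.
    exists j; split=> // [|Qi2]; last by rewrite Qi2 in big.
    by rewrite -(card_axis f_dec) eq_ij (card_axis g_dec).
  have Qi2 : #|Q i| = 2 by apply/eqP; rewrite eqn_leq small Q_gt1.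
  have iS : i \in S by rewrite memS Qi2.
  have lt_i : index i S < size S' by rewrite -szS index_mem.
  have: 0 < size S' by apply: leq_ltn_trans lt_i.
  rewrite -has_predT => /hasP[j0 _ _].
  exists (nth j0 S' (index i S)); split; rewrite ?Qi2 //.
    by apply/eqP; rewrite -memS' mem_nth.
  by rewrite index_uniq // enum_uniq.
exists t; split=> [i k eq_t | i | i]; try by case: (tP i).
have [Ri big_i sm_i] := tP i; have [Rk big_k sm_k] := tP k.
have eqQ : #|Q i| = #|Q k| by rewrite -Ri eq_t.
have [big | small] := ltnP 2 #|Q i|.
  by apply: (axis_of_inj f_dec Q_gt1); rewrite big_i // eq_t big_k // -eqQ.
have Qi2 : #|Q i| = 2 by apply/eqP; rewrite eqn_leq small Q_gt1.
have iS : i \in S by rewrite memS Qi2.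
have kS : k \in S by rewrite memS -eqQ Qi2.
by rewrite -(nth_index i iS) sm_i // eq_t -sm_k -?eqQ // nth_index.
Qed.

Lemma card_indices : #|I| = #|J|.
Proof. by rewrite -(cardsC (big_factors Q)) card_big card_small cardsC. Qed.

End Comparison.
End Decompositions.

(** * Coordinates in a product of cyclic groups *)

Section Cyclic.
Import GRing.Theory.
Variables (m : nat) (n : 'I_m -> nat).
Hypothesis n_gt1 : forall i, 1 < n i.
Local Open Scope ring_scope.

Definition coordinate (i : 'I_m) (x : Zprod n) : 'Z_(n i) := x i.

Lemma ZprodM (x y : Zprod n) i : (x * y)%g i = x i + y i.
Proof. by rewrite ffunE. Qed.

Lemma coordinate_dec : decomposition coordinate.
Proof.
split=> [i x y | x y eq_xy | y]; first exact: ZprodM.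
  by apply/ffunP.
by exists [ffun i => y i] => i; rewrite /coordinate ffunE.
Qed.

Lemma card_Z_n i : #|'Z_(n i)| = n i.
Proof. by rewrite card_ord Zp_cast. Qed.

Lemma avoiding_coordinate :
  avoiding coordinate (fun i => 0) = ~: zero_coord_set n.
Proof.
apply/setP=> x; rewrite !inE negb_exists; by apply: eq_forallb => i.
Qed.

Lemma Zprod_abelian : abelian [set: Zprod n].
Proof.
apply/centsP=> x _ y _; apply/ffunP=> i.
by rewrite !ffunE; apply: addrC.
Qed.

Lemma Zp_double_eq0 i (a : 'Z_(n i)) : a + a = 0 ->
  a = 0 \/ ~~ odd (n i) /\ a = half_mul (n i) 1.
Proof.
have lt_a : (a < n i)%N by rewrite -[X in (_ < X)%N]Zp_cast.
move=> aa0; have: (n i %| (a : nat) + a)%N.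
  move/(congr1 val): aa0 => /=; move: (nat_of_ord a) => a0.
  by rewrite Zp_cast // => /eqP.
case/dvdnP=> [[|[|q]]] // eq_a.
- by left; apply: val_inj => /=; lia.
- right; split; first by lia.
  by apply: val_inj; rewrite /half_mul /= val_Zp_nat //= muln1 modn_small; lia.
lia.
Qed.

Lemma half_mulD i (a b : 'Z_2) : ~~ odd (n i) ->
  half_mul (n i) (a + b) = half_mul (n i) a + half_mul (n i) b.
Proof.
move=> even_n; have n2 : ((n i)./2 + (n i)./2)%N = n i.
  by rewrite addnn even_halfK.
rewrite /half_mul -natrD -mulnDr /=.
have [lt_ab | ] := ltnP (a + b) 2; first by rewrite modn_small.
case: a b => [[|[|//]] ?] [[|[|//]] ?] //= _.
by rewrite muln0 muln2 -addnn n2 char_Zp.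
Qed.

Lemma half_mul_eq0 i (a : 'Z_2) : ~~ odd (n i) -> half_mul (n i) a = 0 -> a = 0.
Proof.
move=> even_n /(congr1 val); rewrite /half_mul /= val_Zp_nat //.
case: a => [[|[|//]] lt_a] /=; first by move=> _; apply: val_inj.
have := n_gt1 i.
by move=> n2 half0; exfalso; move: half0; rewrite modn_small; lia.
Qed.

(** Matching on the proof of [k != i] makes ['Z_(n k)] the type of the entry of
    [y], without any transport. *)
Definition extend (i : 'I_m) (y : Zprod (@others_n m n i)) : Zprod n :=
  [ffun k => match @idP (k != i) with
             | ReflectT ki => (y (exist _ k ki) : 'Z_(n k))
             | ReflectF _ => 0
             end].

Lemma extend_at (i : 'I_m) (y : Zprod (@others_n m n i)) : extend y i = 0.
Proof. by rewrite ffunE; case: {-}_ / idP => // ii; case/negP: (ii). Qed.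

Lemma extend_off (i : 'I_m) (y : Zprod (@others_n m n i))
    (k : {k : 'I_m | k != i}) : extend y (val k) = y k.
Proof.
case: k => k ki; rewrite ffunE; case: {-}_ / idP => [ki'|//].
by rewrite (bool_irrelevance ki' ki).
Qed.

Lemma extendP (i : 'I_m) (y : Zprod (@others_n m n i)) (x : Zprod n) :
  x i = 0 -> (forall k : {k : 'I_m | k != i}, x (val k) = y k) -> x = extend y.
Proof.
move=> xi xk; apply/ffunP=> k; have [->|ki] := eqVneq k i.
  by rewrite extend_at.
by have := xk (exist _ k ki); rewrite -extend_off.
Qed.

Lemma extendM (i : 'I_m) : {morph @extend i : x y / (x * y)%g}.
Proof.
move=> x y; apply/esym/extendP => [|k].
  by rewrite ZprodM !extend_at addr0.
by rewrite ZprodM !extend_off ffunE.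
Qed.

Lemma extend_evec (i : 'I_m) (k : {k : 'I_m | k != i}) :
  extend (evec (@others_n m n i) k) \in axis coordinate (val k).
Proof.
apply/axisP=> l lk; rewrite /coordinate; have [->|li] := eqVneq l i.
  exact: extend_at.
have := extend_off (evec (@others_n m n i) k) (exist _ l li) => /= ->.
by rewrite ffunE -val_eqE /= (negPf lk).
Qed.

Lemma extend_drop_coord (i : 'I_m) (x : Zprod n) :
  ((extend (drop_coord i x))^-1 * x)%g \in axis coordinate i.
Proof.
apply/axisP=> k ki; rewrite (decM coordinate_dec) (decV coordinate_dec).
have := extend_off (drop_coord i x) (exist _ k ki).
by rewrite /coordinate /= => ->; rewrite ffunE /= mulVg.
Qed.

Lemma extend_ones (i : 'I_m) : extend (ones (@others_n m n i)) = zvec n i.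
Proof.
apply/esym/extendP => [|k]; rewrite !ffunE ?eqxx //.
by rewrite (valP k).
Qed.

(** The difference [psi] of [p] and the [i]-th coordinate vanishes on the axis
    [i] and on the axes of order greater than 2, and the axes of order 2 are
    killed by doubling. As the axes generate, the values of [psi] are killed by
    doubling: they are [0], or half of [n i] when it is even. So [psi] is zero
    if [n i] is odd, and otherwise is [half_mul (n i)] composed with a morphism
    to Z/2. *)
Lemma projection_nearly (i : 'I_m) (p : Zprod n -> 'Z_(n i)) :
  (forall x y, p (x * y)%g = p x + p y) ->
  {in axis coordinate i, forall x, p x = x i} ->
  (forall k, k != i -> (2 < n k)%N ->
    {in axis coordinate k, forall x, p x = 0}) ->
  nearly_Z i [set x | p x == p (zvec n i)].
Proof.
move=> pM p_i p_big; pose psi x := p x - x i.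
have psiM x y : psi (x * y)%g = psi x + psi y.
  by rewrite /psi pM ZprodM addrACA opprD.
have psi_i x : x \in axis coordinate i -> psi x = 0.
  by move=> x_i; rewrite /psi p_i ?subrr.
have psi_big k x : (2 < n k)%N -> x \in axis coordinate k -> psi x = 0.
  move=> nk x_k; have [ki|ki] := eqVneq k i; first by apply: psi_i; rewrite -ki.
  rewrite /psi (p_big k) // sub0r -[x i]/(coordinate i x).
  rewrite (axisP _ _ _ x_k) ?oppr0 //.
  by rewrite eq_sym.
have psi2 x : psi x + psi x = 0.
  pose h y := psi y + psi y.
  apply: (@axes_generate _ _ _ _ coordinate_dec _ h) => [y z | k y y_k].
    by rewrite /h psiM addrACA.
  have [nk|nk] := ltnP 2 (n k); first by rewrite /h (psi_big k) ?addr0.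
  have nk2 : n k = 2 by apply/eqP; rewrite eqn_leq nk n_gt1.
  rewrite /h -psiM; apply: psi_i; apply/axisP=> l li.
  rewrite (decM coordinate_dec); have [->|lk] := eqVneq l k; last first.
    by rewrite (axisP _ _ _ y_k) ?mulg1.
  apply: val_inj => /=; case: (coordinate k y) => a /=; rewrite nk2.
  by case: a => [|[|]].
have psi_extend x : psi (extend (drop_coord i x)) = psi x.
  rewrite -{2}[x](mulKVg (extend (drop_coord i x))) psiM.
  by rewrite [psi (_^-1 * _)%g]psi_i ?addr0 // extend_drop_coord.
have zi : zvec n i i = 0 by rewrite ffunE eqxx.
have pE x : p x = x i + psi x by rewrite addrC subrK.
(* The sign of [psi x] does not matter, by [psi2]. *)
have inE_psi x : (p x == p (zvec n i)) = (x i == psi x + psi (zvec n i)).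
  rewrite !pE zi add0r; apply/eqP/eqP=> [<- | ->].
    by rewrite addrCA psi2 addr0.
  by rewrite addrAC psi2 add0r.
rewrite /nearly_Z; case: ifP => [odd_n | /negbT even_n].
  have psi0 x : psi x = 0.
    by case/Zp_double_eq0: (psi2 x) => [//|[/negP]].
  by apply/setP=> x; rewrite !inE inE_psi !psi0 addr0.
pose phi (y : Zprod (@others_n m n i)) : 'Z_2 := (psi (extend y) != 0)%:R.
have phiE y : half_mul (n i) (phi y) = psi (extend y).
  rewrite /phi; case/Zp_double_eq0: (psi2 (extend y)) => [->|[_ psi_r]].
    by rewrite eqxx /half_mul muln0.
  rewrite psi_r; case: eqP => [half0|//].
  by have := half_mul_eq0 even_n half0.
have half_inj (a b : 'Z_2) : half_mul (n i) a = half_mul (n i) b -> a = b.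
  move=> eq_ab; apply/eqP; rewrite -subr_eq0; apply/eqP.
  apply: (half_mul_eq0 even_n).
  have b2 : b + b = 0 by apply: val_inj; case: b {eq_ab} => [[|[|//]]].
  have -> : - b = b by apply/eqP; rewrite -subr_eq0 -opprD b2 oppr0.
  by rewrite half_mulD // eq_ab -half_mulD // b2 /half_mul muln0.
have phiM : {in [set: Zprod (@others_n m n i)] &,
    {morph phi : x y / (x * y)%g}}.
  move=> x y _ _; apply: half_inj.
  by rewrite [RHS](half_mulD _ _ even_n) !phiE extendM psiM.
exists (Morphism phiM); split=> [k /= phi_k | ].
  apply/eqP; rewrite eqn_leq n_gt1 andbT leqNgt; apply/negP=> nk; apply: phi_k.
  by rewrite /phi (psi_big (val k)) ?eqxx // extend_evec.
apply/setP=> x; rewrite !inE inE_psi half_mulD //= !phiE.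
by rewrite psi_extend extend_ones.
Qed.

(** * Hyperplane splittings *)

Lemma normal_Zprod (G : {group Zprod n}) x : x \in 'N(G)%g.
Proof.
have /subsetP := sub_abelian_norm Zprod_abelian (subsetT G).
by apply; rewrite inE.
Qed.

Lemma coset_ZprodM (G : {group Zprod n}) : {morph coset G : x y / (x * y)%g}.
Proof. by move=> x y; rewrite morphM ?normal_Zprod. Qed.

Lemma coset_Zprod_eq1 (G : {group Zprod n}) x : (coset G x == 1%g) = (x \in G).
Proof.
by apply/eqP/idP=> [|/coset_id//]; apply/coset_idr/normal_Zprod.
Qed.

Lemma mem_lcoset_coset (G : {group Zprod n}) x y :
  (y \in x *: G)%g = (coset G y == coset G x).
Proof.
rewrite mem_lcoset -coset_Zprod_eq1 coset_ZprodM morphV ?normal_Zprod //.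
by rewrite -eq_mulVg1 eq_sym.
Qed.

Lemma coset_surj (G : {group Zprod n}) (q : coset_of G) :
  exists x, coset G x = q.
Proof. by have [x _ ->] := cosetP q; exists x. Qed.

(** By its order, the axis [i] is a transversal of [G]. The [i]-th coordinate of
    the representative of [x] in that transversal identifies the quotient by
    [G] with ['Z_(n i)]; this is the map [p] of [projection_nearly]. *)
Lemma axis_transversal_nearly (G : {group Zprod n}) (i : 'I_m) :
  #|{: coset_of G}| = n i ->
  {in axis coordinate i, forall v, v \in G -> v = 1%g} ->
  (forall k, k != i -> (2 < n k)%N -> axis coordinate k \subset G) ->
  nearly_Z i (zvec n i *: G)%g.
Proof.
move=> cardG G_i G_big.
have coset_inj : {in axis coordinate i &, injective (coset G)}.
  move=> x y x_i y_i eq_xy; apply/eqP; rewrite eq_mulVg1; apply/eqP.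
  apply: G_i; first by rewrite (axisM coordinate_dec) ?(axisV coordinate_dec).
  by rewrite -mem_lcoset mem_lcoset_coset eq_xy.
have coset_onto q : exists2 v, v \in axis coordinate i & coset G v = q.
  have : q \in coset G @: axis coordinate i.
    suff -> : coset G @: axis coordinate i = setT by rewrite inE.
    apply/eqP; rewrite eqEcard subsetT cardsT cardG card_in_imset //.
    by rewrite (card_axis coordinate_dec) card_Z_n leqnn.
  by case/imsetP=> v v_i ->; exists v.
have /fin_all_exists2[r r_i r_coset] x : exists2 v,
    v \in axis coordinate i & coset G v = coset G x by apply: coset_onto.
have r_eq x v : v \in axis coordinate i -> coset G v = coset G x -> r x = v.
  by move=> v_i eq_v; apply: coset_inj; rewrite ?r_coset.
pose p x := r x i.
have -> : (zvec n i *: G)%g = [set x | p x == p (zvec n i)].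
  apply/setP=> x; rewrite inE mem_lcoset_coset -(r_coset x).
  rewrite -(r_coset (zvec n i)); apply/eqP/eqP=> [eq_r | eq_p].
    by rewrite /p (coset_inj _ _ (r_i x) (r_i (zvec n i)) eq_r).
  congr (coset G _).
  exact: (axis_inj coordinate_dec (r_i x) (r_i (zvec n i)) eq_p).
apply: projection_nearly => [x y | x x_i | k ki nk x x_k].
- rewrite -ZprodM /p (r_eq (x * y)%g (r x * r y)%g) //.
    by rewrite (axisM coordinate_dec).
  by rewrite !coset_ZprodM !r_coset.
- by rewrite /p (r_eq x x).
rewrite /p (r_eq x 1%g) ?ffunE ?(axis1 coordinate_dec) //.
have /eqP -> : coset G x == 1%g.
  by rewrite coset_Zprod_eq1; apply: (subsetP (G_big k ki nk)).
by apply/eqP; rewrite coset_Zprod_eq1 group1.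
Qed.

Section Splitting.
Variables (m' : nat) (H : 'I_m' -> {set Zprod n}).
Variable H' : 'I_m' -> {group Zprod n}.
Hypothesis splitH : hyperplane_splitting H H'.
Hypothesis unionH : hyperplane_union H = zero_coord_set n.

Definition translate_coset j (x : Zprod n) : coset_of (H' j) := coset (H' j) x.

Lemma translate_coset_dec : decomposition translate_coset.
Proof.
have [_ /misomP[fM /isomP[inj_f im_f]]] := splitH.
split=> [j | x y eq_xy | y]; first exact: coset_ZprodM.
  apply: (injmP inj_f); rewrite ?inE //=.
  by apply/ffunP=> j; rewrite !ffunE; apply: eq_xy.
have: [ffun j => y j] \in (morphm fM @* setT)%g by rewrite im_f; apply: in_setT.
case/morphimP=> x _ _ eq_y; exists x => j.
by have := congr1 (fun h : {dffun _} => h j) eq_y; rewrite !ffunE.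
Qed.

Lemma card_translate_coset j : (1 < #|{: coset_of (H' j)}|)%N.
Proof.
have [/(_ j)[[/properP[_ [x _ xH]] _] _] _] := splitH.
rewrite (cardD1 1%g) (cardD1 (coset (H' j) x)) !inE.
by rewrite coset_Zprod_eq1 xH.
Qed.

Lemma avoiding_translates : exists d : (forall j, coset_of (H' j)),
  avoiding translate_coset d = ~: zero_coord_set n /\
  forall j x, (x \in H j) = (coset (H' j) x == d j).
Proof.
have [affH _] := splitH.
have /fin_all_exists[d dP] j :
    exists q, forall x, (x \in H j) = (coset (H' j) x == q).
  have [_ [y ->]] := affH j; exists (coset (H' j) y) => x.
  exact: mem_lcoset_coset.
exists d; split=> //; rewrite -unionH; apply/setP=> x; rewrite !inE.
apply/forallP/negP=> [xd /bigcupP[j _] | xH j].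
  by rewrite dP (negPf (xd j)).
by rewrite -dP; apply/negP=> x_j; apply: xH; apply/bigcupP; exists j.
Qed.

Lemma splitting_match : exists t : 'I_m -> 'I_m',
  [/\ injective t, m = m',
      forall i, (2 < n i)%N -> zvec n i \in H (t i),
      forall i, exists k, nearly_Z k (H (t i))
    & forall i, #|{: coset_of (H' (t i))}| = n i].
Proof.
have [d [avoid_d Hd]] := avoiding_translates.
have eqD := etrans avoiding_coordinate (esym avoid_d).
have Z_gt1 i : (1 < #|'Z_(n i)|)%N by rewrite card_Z_n.
have f_dec := coordinate_dec; have g_dec := translate_coset_dec.
have [t [t_inj t_card t_axis]] :=
  factors_match f_dec g_dec Z_gt1 card_translate_coset eqD.
have eq_mm' := card_indices f_dec g_dec Z_gt1 card_translate_coset eqD.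
rewrite !card_ord in eq_mm'.
have card_t i : #|{: coset_of (H' (t i))}| = n i by rewrite t_card card_Z_n.
(* The shift has nonzero coordinates: [v i] at [i], and 1 elsewhere. *)
have zvec_shift i v j : v \in axis coordinate i -> v != 1%g ->
    coset (H' j) (zvec n i * v)%g != d j.
  move=> v_i v1; suff: (zvec n i * v)%g \in avoiding translate_coset d.
    by rewrite inE => /forallP/(_ j).
  rewrite -eqD inE; apply/forallP=> k; rewrite /coordinate ZprodM ffunE.
  have [->|ki] := eqVneq k i; first by rewrite add0r; apply: (axis_neq1 f_dec).
  by rewrite -[v k]/(coordinate k v) (axisP _ _ _ v_i) // addr0 Zp_nontrivial.
have ex_axis i : exists2 v, v \in axis coordinate i & v != 1%g.
  have [v v_i v1] := axis_coord f_dec (1%R : 'Z_(n i)); exists v => //.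
  by apply: contra_eq_neq v1 => ->; rewrite (dec1 f_dec) eq_sym oner_neq0.
have zvec_meets i : exists j, zvec n i \in H j.
  have: zvec n i \in zero_coord_set n.
    by rewrite inE; apply/existsP; exists i; rewrite ffunE eqxx.
  by rewrite -unionH => /bigcupP[j _]; exists j.
(* The points [zvec n i * v], where [v] is on the axis [i] and nontrivial, avoid
   all the hyperplanes, and share all the cosets of [zvec n i] but the one of
   [t i]. *)
have zvec_big i : (2 < n i)%N -> zvec n i \in H (t i).
  move=> ni; have [j zj] := zvec_meets i.
  have [<-//|tj] := eqVneq j (t i).
  have [v v_i v1] := ex_axis i; have := zvec_shift i v j v_i v1.
  rewrite t_axis ?card_Z_n // in v_i.
  rewrite coset_ZprodM [coset _ v](axisP _ _ _ v_i) // mulg1 -Hd.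
  by rewrite zj.
have H_coset i j : zvec n i \in H j -> H j = (zvec n i *: H' j)%g.
  by rewrite Hd => /eqP zd; apply/setP=> x; rewrite mem_lcoset_coset zd Hd.
have big_sub k i : (2 < n k)%N -> k != i -> axis coordinate k \subset H' (t i).
  move=> nk ki; apply/subsetP=> v; rewrite t_axis ?card_Z_n // => v_k.
  rewrite -coset_Zprod_eq1 [coset _ v](axisP _ _ _ v_k) //.
  by rewrite (inj_eq t_inj) eq_sym.
exists t; split=> // i; have [ni|ni] := ltnP 2 (n i).
  exists i; rewrite (H_coset i) ?zvec_big //.
  apply: axis_transversal_nearly => //.
    move=> v; rewrite t_axis ?card_Z_n // => v_i vH.
    apply/eqP; apply: contraTT vH => /(axis_neq1 g_dec v_i).
    by rewrite -coset_Zprod_eq1.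
  by move=> k ki nk; apply: big_sub.
have ni2 : n i = 2 by apply/eqP; rewrite eqn_leq ni n_gt1.
(* The index [i] was paired with [t i] by rank only, so the coordinate of
   which [H (t i)] is nearly the zero set has to be found anew. *)
set j := t i.
have [k [v v_k vH]] :
    exists k, exists2 v, v \in axis coordinate k & v \notin H' j.
  have [q q1] : exists q : coset_of (H' j), q != 1%g.
    have : (0 < #|[set~ 1%g : coset_of (H' j)]|)%N.
      by rewrite cardsC1 ltn_predRL card_translate_coset.
    by case/card_gt0P=> q; rewrite inE inE; exists q.
  have [x xq] := coset_surj q.
  suff /existsP[k /exists_inP[v v_k vH]] :
      [exists k, [exists v in axis coordinate k, v \notin H' j]].
    by exists k, v.
  apply: contraNT q1; rewrite negb_exists => /forallP none.
  rewrite -xq; apply/eqP.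
  apply: (axes_generate f_dec (@coset_ZprodM (H' j))) => k v v_k.
  have := none k; rewrite negb_exists_in => /forall_inP/(_ v v_k).
  by rewrite negbK -coset_Zprod_eq1 => /eqP.
have nk2 : n k = 2.
  apply/eqP; rewrite eqn_leq n_gt1 andbT leqNgt; apply: contra vH => nk.
  apply: (subsetP (big_sub k i nk _)) => //.
  by apply: contraTneq nk => ->; rewrite ni2.
have v1 : v != 1%g by apply: contraNneq vH => ->; apply: group1.
have v_only w : w \in axis coordinate k -> w != 1%g -> w = v.
  move=> w_k w1; apply: (axis_inj f_dec w_k v_k); apply: val_inj.
  have := axis_neq1 f_dec w_k w1; have := axis_neq1 f_dec v_k v1.
  rewrite -!val_eqE /=.
  case: (coordinate k v) (coordinate k w) => [a lt_a] [b lt_b] /=.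
  by move: lt_a lt_b; rewrite Zp_cast // nk2; lia.
exists k; rewrite (H_coset k).
  apply: axis_transversal_nearly; first by rewrite card_t ni2 nk2.
    move=> w w_k wH; apply/eqP; apply: contraTT wH => w1.
    by rewrite (v_only w).
  move=> l lk nl; apply: big_sub => //.
  by apply: contraTneq nl => ->; rewrite ni2.
(* Of the two cosets of [H' j], those of [zvec n k] and of its shift by [v] are
   distinct, and the latter is not [d j]. *)
have := zvec_shift k v j v_k v1; rewrite Hd coset_ZprodM.
apply: contraNT => zd.
have := max_card (mem [:: d j; coset (H' j) (zvec n k);
                          (coset (H' j) (zvec n k) * coset (H' j) v)%g]).
rewrite card_t ni2 => card_le; apply: contraTT card_le => zvd.
rewrite (card_uniqP _) //= !inE !negb_or.
rewrite eq_sym zd eq_sym zvd -[X in X != _]mulg1 (inj_eq (mulgI _)) /= andbT.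
by rewrite eq_sym coset_Zprod_eq1.
Qed.

End Splitting.
End Cyclic.

Theorem theorem12 (m : nat) (n : 'I_m -> nat) (n_gt1 : forall i, 1 < n i)
    (m' : nat) (H : 'I_m' -> {set Zprod n}) (H' : 'I_m' -> {group Zprod n})
    (splitH : hyperplane_splitting H H')
    (unionH : hyperplane_union H = zero_coord_set n) :
  exists (eq_mm' : m = m') (s : {perm 'I_m'}),
    let idx (i : 'I_m) : 'I_m' := s (cast_ord eq_mm' i) in
    [/\ forall i : 'I_m, 2 < n i -> zvec n i \in H (idx i),
        forall i : 'I_m, nearly_coordinate (H (idx i))
      & forall i : 'I_m, cyclic ([set: Zprod n] / H' (idx i))
                         /\ #|([set: Zprod n] / H' (idx i))%g| = n i].
Proof.
have [t [t_inj eq_mm' t_big t_nearly t_card]] :=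
  splitting_match n_gt1 splitH unionH.
have s_inj : injective (fun j => t (cast_ord (esym eq_mm') j)).
  by move=> j k /t_inj/cast_ord_inj.
exists eq_mm', (perm s_inj) => idx.
have idxE i : idx i = t i by rewrite /idx permE cast_ordK.
have [affH _] := splitH.
split=> i; rewrite idxE; [exact: t_big | exact: t_nearly | split].
  by have [[_ cyc] _] := affH (t i).
rewrite -(t_card i) -cardsT; congr #|pred_of_set _|.
apply/setP=> q; rewrite inE; have [x x_N ->] := cosetP q.
by rewrite mem_quotient ?inE.
Qed.
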